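(* Let $G=(V,E)$ be a graph with at least two vertices. Let $\mathcal{D}=\{x\in V: d(x)=|V|-2\}$ be the set of quasi-stars of $G$, let $v:\mathcal{D}\to V$ be the map defined by $\{v(x)\}=V\setminus N[x]$, and let $\mathcal{T}=v(\mathcal{D})$ be its image. Then: (a) $\mathcal{T}=\operatorname{ex}(V)$ and $|\mathcal{D}|\geq |\operatorname{ex}(V)|$; (b) $V=N[\mathcal{D}]\cup \operatorname{ex}(V)$ and $N[\mathcal{D}]\cap \operatorname{ex}(V)=\varnothing$; (c) if $G$ is true twins free, then $v$, considered as a map from $\mathcal{D}$ to $\operatorname{ex}(V)$, is a bijection; (d) if $G$ is an $n$-convex geometry, then $|\operatorname{ex}(V)|=|\mathcal{D}|\geq 2$.
   Context: All graphs are finite, simple and undirected, with non-empty vertex set. $d(x)$ denotes the degree of the vertex $x$. For a graph $G=(V,E)$ and $x\in V$, the closed neighbourhood of $x$ is $N[x]=\{x\}\cup\{y\in V:\{x,y\}\in E\}$. $G$ is true twins free if there are no distinct $x,y\in V$ with $N[x]=N[y]$. For $Y\subseteq V$, the common closed neighbourhood is $N[Y]=\bigcap_{y\in Y}N[y]$ if $Y\neq\varnothing$, and $N[\varnothing]=V$. The neighbourhood convexity of $G$ is the family $n_G=\{N[Y]:Y\subseteq V\}\cup\{\varnothing\}$ of subsets of $V$; it contains $\varnothing$ and $V$ and is closed under intersection. Its members are called $n$-convex sets. For $X\subseteq V$ the convex hull $[X]_{n}$ is the intersection of all $n$-convex sets containing $X$. For an $n$-convex set $K$, $\operatorname{ex}(K)=\{x\in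 K: K\setminus\{x\}\in n_G\}$ is the set of extreme points of $K$. $G$ is an $n$-convex geometry if $K=[\operatorname{ex}(K)]_{n}$ for every $n$-convex set $K$. If $\mathcal{D}=\varnothing$, then $v$ is the empty function, with empty image. *)

(* Defs.v *)
From HB Require Import structures.
From mathcomp Require Import all_boot.

Set Implicit Arguments.
Unset Strict Implicit.
Unset Printing Implicit Defensive.

Record sgraph := SGraph {
  vertex :> finType;
  edge : rel vertex;
  edge_sym : symmetric edge;
  edge_irrefl : irreflexive edge }.

Section Graph.
Variable G : sgraph.
Implicit Types (x y : G) (X Y K : {set G}).

Definition degree x : nat := #|[set y | edge x y]|.

Definition clnbh x : {set G} := x |: [set y | edge x y].

Definition true_twins_free : Prop :=
  ~ exists x y, x <> y /\ clnbh x = clnbh y.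

(* The intersection over the empty index set is setT, so that
   common_clnbh set0 = [set: G]. *)
Definition common_clnbh Y : {set G} := \bigcap_(y in Y) clnbh y.

Definition nconvexity : {set {set G}} :=
  set0 |: [set common_clnbh Y | Y : {set G}].

Definition nhull X : {set G} := \bigcap_(K in nconvexity | X \subset K) K.

Definition extreme K : {set G} := [set x in K | K :\ x \in nconvexity].

Definition nconvex_geometry : Prop :=
  forall K, K \in nconvexity -> K = nhull (extreme K).

(* d(x) = |V| - 2, without truncated subtraction. *)
Definition quasi_stars : {set G} := [set x | degree x + 2 == #|G|].

Lemma quasi_star_missed x :
  x \in quasi_stars -> exists y, ~: clnbh x == [set y].
Proof.
rewrite inE => /eqP dx.
have: #|~: clnbh x| == 1.
  have := cardsC (clnbh x); rewrite cardsU1 inE edge_irrefl -/(degree x) -dx.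
  by rewrite addn2 -addn1 -[(degree x).+1]add1n => /addnI ->.
by case/cards1P=> y ->; exists y.
Qed.

Definition missed (x : {x : G | x \in quasi_stars}) : G :=
  xchoose (quasi_star_missed (valP x)).

Lemma missedE (x : {x : G | x \in quasi_stars}) :
  [set missed x] = ~: clnbh (val x).
Proof. by apply/esym/eqP; exact: xchooseP (quasi_star_missed (valP x)). Qed.

Definition missed_set : {set G} :=
  [set missed x | x : {x : G | x \in quasi_stars}].

End Graph.

Arguments true_twins_free : clear implicits.
Arguments nconvexity : clear implicits.
Arguments nconvex_geometry : clear implicits.
Arguments quasi_stars : clear implicits.
Arguments missed_set : clear implicits.

(* Main.v *)
Require Import Defs.
From HB Require Import structures.
From mathcomp Require Import all_boot.

(** An intersection of closed neighbourhoods that misses exactly one vertex [x]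
    is itself a closed neighbourhood [N[y]], so the extreme points of [V] are the
    vertices missed by a quasi-star.  In a convex geometry, the hull of a vertex
    [x] with a true twin would have no extreme point: [x] cannot be removed
    without its twin, and no other vertex can be removed by minimality.  Hence
    convex geometries are true twins free.  A single extreme point [z] would
    give [V = [z] = N[z]], but [z] is not adjacent to the quasi-star missing
    it. *)

Section NeighbourhoodConvexity.
Variable G : sgraph.
Implicit Types (x y z : G) (Y K : {set G}).

Lemma in_clnbh x y : (y \in clnbh x) = (y == x) || edge x y.
Proof. by rewrite !inE. Qed.

Lemma clnbh_sym x y : (y \in clnbh x) = (x \in clnbh y).
Proof. by rewrite !in_clnbh eq_sym edge_sym. Qed.

Lemma common_clnbh_nconvex Y : common_clnbh Y \in nconvexity G.
Proof. by rewrite !inE imset_f ?orbT. Qed.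

Lemma clnbh_nconvex x : clnbh x \in nconvexity G.
Proof.
have -> : clnbh x = common_clnbh [set x] by rewrite /common_clnbh big_set1.
exact: common_clnbh_nconvex.
Qed.

Lemma setT_nconvex : [set: G] \in nconvexity G.
Proof.
have -> : [set: G] = common_clnbh set0 by rewrite /common_clnbh big_set0.
exact: common_clnbh_nconvex.
Qed.

Lemma set0_nconvex : set0 \in nconvexity G.
Proof. by rewrite !inE eqxx. Qed.

Lemma quasi_starP x z : ~: clnbh x = [set z] -> x \in quasi_stars G.
Proof.
(* Splitting [V] into [N[x]] and its one-vertex complement gives [#|G| = (1 + degree x) + 1]. *)
move=> cx; rewrite inE -(cardsC (clnbh x)) cx cards1.
by rewrite cardsU1 inE edge_irrefl /degree addn2 addn1 add1n.
Qed.

Lemma missedP z :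
  reflect (exists2 x, x \in quasi_stars G & ~: clnbh x = [set z])
          (z \in missed_set G).
Proof.
apply: (iffP imsetP) => [[x _ ->] | [x Dx cx]].
  by exists (val x); [exact: valP | rewrite missedE].
exists (exist _ x Dx) => //; apply: set1_inj.
by rewrite missedE.
Qed.

Lemma missed_set_extreme : 2 <= #|G| -> missed_set G = extreme [set: G].
Proof.
move=> G_ge2; apply/setP => z; rewrite [RHS]inE in_setT setTD /=.
apply/missedP/idP => [[x _ cx] | ].
  by rewrite -cx setCK clnbh_nconvex.
rewrite !inE => /orP[/eqP z0 | /imsetP[Y _ defY]].
  (* If [V] minus [z] is empty, then [z] is the only vertex. *)
  by move: G_ge2; rewrite -(cardsC [set z]) z0 cards0 cards1.
have : z \notin common_clnbh Y by rewrite -defY !inE eqxx.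
case: (boolP [exists y in Y, z \notin clnbh y]) => [/exists_inP[y Yy zy] _ | ].
  suff cy : ~: clnbh y = [set z] by exists y => //; apply: quasi_starP cy.
  (* As [y] is in [Y], [N[y]] contains [N[Y]], which is [V] minus [z]; hence [N[y]] can miss only
     [z]. *)
  apply/eqP; rewrite eqEsubset sub1set in_setC zy andbT -setCS setCK defY.
  exact: bigcap_inf.
rewrite negb_exists_in => /forall_inP Yz /negP[].
by apply/bigcapP => y /Yz /negPn.
Qed.

Lemma common_clnbh_quasi_stars :
  common_clnbh (quasi_stars G) = ~: missed_set G.
Proof.
apply/setP => z; rewrite in_setC; apply/bigcapP/negP => [Nz /missedP[x Dx cx] | Tz x Dx].
  by have := Nz x Dx; rewrite -[clnbh x]setCK cx !inE eqxx.
apply/negPn/negP => xz; apply/Tz/missedP; exists x => //.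
have [y /eqP cx] := quasi_star_missed Dx.
by move: xz; rewrite -in_setC cx => /set1P ->.
Qed.

Lemma card_missed_set_le : #|missed_set G| <= #|quasi_stars G|.
Proof. by apply: leq_trans (leq_imset_card _ _) _; rewrite card_sig. Qed.

(** The closed neighbourhood of a quasi-star is the complement of its missed vertex, so quasi-stars
    missing the same vertex are twins. *)
Lemma missed_inj : true_twins_free G -> injective (@missed G).
Proof.
move=> ttf a b eq_ab; apply: val_inj; case: (eqVneq (val a) (val b)) => // ne_ab.
case: ttf; exists (val a), (val b); split; first exact/eqP.
by apply: setC_inj; rewrite -!missedE eq_ab.
Qed.

Lemma card_missed_set : true_twins_free G -> #|missed_set G| = #|quasi_stars G|.
Proof. by move=> /missed_inj inj_m; rewrite card_imset // card_sig. Qed.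

Lemma nhull_sub Y K : K \in nconvexity G -> Y \subset K -> nhull Y \subset K.
Proof. by move=> cK sYK; apply: bigcap_inf; rewrite cK. Qed.

Lemma sub_nhull Y : Y \subset nhull Y.
Proof. by apply/bigcapsP => K /andP[]. Qed.

Lemma nhull0 : nhull set0 = set0 :> {set G}.
Proof. by apply/eqP; rewrite -subset0 nhull_sub ?set0_nconvex. Qed.

Lemma common_clnbhI Y Z :
  common_clnbh Y :&: common_clnbh Z = common_clnbh (Y :|: Z) :> {set G}.
Proof. by rewrite /common_clnbh bigcap_setU. Qed.

Lemma nhull_nconvex Y : nhull Y \in nconvexity G.
Proof.
apply: (big_ind (fun K => K \in nconvexity G)) => [|A B|K /andP[]//]; first exact: setT_nconvex.
rewrite [A \in _]inE [B \in _]inE.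
case/orP=> [/set1P -> | /imsetP[X _ ->]]; first by rewrite set0I set0_nconvex.
case/orP=> [/set1P -> | /imsetP[Z _ ->]]; first by rewrite setI0 set0_nconvex.
by rewrite common_clnbhI common_clnbh_nconvex.
Qed.

(** By symmetry of adjacency, [x] lies in [N[Y]] exactly when [Y] is contained in [N[x]], a
    condition on [N[x]] alone. *)
Lemma nconvex_twins x y K :
  clnbh x = clnbh y -> K \in nconvexity G -> (x \in K) = (y \in K).
Proof.
move=> Nxy; rewrite inE => /orP[/set1P -> | /imsetP[Y _ ->]]; first by rewrite !inE.
by apply/bigcapP/bigcapP => YK z /YK; rewrite !(clnbh_sym z) Nxy.
Qed.

Lemma nconvex_geometry_twins_free : nconvex_geometry G -> true_twins_free G.
Proof.
move=> geo [x [y [ne_xy Nxy]]].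
pose K := nhull [set x].
have cK : K \in nconvexity G := nhull_nconvex _.
have Kx : x \in K by rewrite -sub1set sub_nhull.
have Ky : y \in K by rewrite -(nconvex_twins _ _ _ Nxy cK).
suff exK : extreme K = set0 by move: Kx; rewrite (geo K cK) exK nhull0 inE.
apply/setP => z; rewrite inE [RHS]inE; apply/negbTE/andP => -[Kz cKz].
have [eq_zx | ne_zx] := eqVneq z x.
  (* Removing [x] leaves its twin [y] behind, so the remainder is not convex. *)
  have := nconvex_twins _ _ _ Nxy cKz; rewrite eq_zx !inE eqxx Ky andbT /=.
  by move/esym/negbFE/eqP/esym.
(* Here [K :\ z] would be a convex set containing [x], hence containing the whole hull [K],
   including [z]. *)
have : z \in K :\ z.
  by apply: (subsetP (nhull_sub [set x] _ cKz _)); rewrite // sub1set !inE eq_sym ne_zx.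
by rewrite !inE eqxx.
Qed.

Lemma nconvex_geometry_card_extreme :
  2 <= #|G| -> nconvex_geometry G -> 2 <= #|extreme [set: G]|.
Proof.
move=> G_ge2 geo.
have defV := geo _ setT_nconvex; rewrite ltnNge leq_eqVlt ltnS leqn0 cards_eq0.
apply/orP => -[/cards1P[z exz] | /eqP ex0]; last first.
  (* Without extreme points, [V] would be the hull of the empty set, which is empty. *)
  by move: G_ge2; rewrite -cardsT defV ex0 nhull0 cards0.
have /missedP[x _ cx] : z \in missed_set G by rewrite missed_set_extreme // exz set11.
(* The convex set [N[z]] contains the hull of [z], which is all of [V]. *)
have : x \in clnbh z.
  apply: (subsetP (nhull_sub [set z] _ (clnbh_nconvex z) _)).
    by rewrite sub1set in_clnbh eqxx.
  by rewrite -exz -defV in_setT.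
by rewrite clnbh_sym -[clnbh x]setCK cx !inE eqxx.
Qed.

End NeighbourhoodConvexity.

Theorem theorem23 (G : sgraph) (G_ge2 : 2 <= #|G|) :
  [/\ missed_set G = extreme [set: G] /\ #|extreme [set: G]| <= #|quasi_stars G|,
      [set: G] = common_clnbh (quasi_stars G) :|: extreme [set: G] /\
        common_clnbh (quasi_stars G) :&: extreme [set: G] = set0,
      true_twins_free G ->
        exists w : {x : G | x \in quasi_stars G} ->
                   {y : G | y \in extreme [set: G]},
          (forall x, val (w x) = missed x) /\ bijective w
    & nconvex_geometry G ->
        #|extreme [set: G]| = #|quasi_stars G| /\ 2 <= #|quasi_stars G| ].
Proof.
have defT := missed_set_extreme G G_ge2; split.
- by rewrite -defT card_missed_set_le.
- by rewrite -defT common_clnbh_quasi_stars setUC setUCr setIC setICr.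
- move=> ttf.
  have exm x : @missed G x \in extreme [set: G] by rewrite -defT imset_f.
  exists (fun x => exist _ (missed x) (exm x)); split=> //.
  (* Injectivity suffices because domain and codomain have equal cardinality. *)
  apply: inj_card_bij => [a b [] | ]; first exact: missed_inj.
  by rewrite !card_sig -defT card_missed_set.
- move=> geo.
  have := nconvex_geometry_card_extreme _ G_ge2 geo.
  by rewrite -defT card_missed_set //; apply: nconvex_geometry_twins_free.
Qed.
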